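(* Let $R$ be a norm-closed right ideal of $\mathcal{M}$ and let $V=\{f(\cdot,y): f\in R,\ y\in\mathfrak{X}\}$. Then $V$ is a norm-closed linear subspace of $\mathbf{C}(\mathfrak{X})$ and the cc-closure of $R$ is equal to $\mathcal{R}_V$. Moreover, if $R$ is pc-closed then $V$ is pc-closed.
   Context: $\mathfrak{X}$ is a fixed compact metrizable space and $\mathfrak{m}$ is a fixed Borel probability measure on $\mathfrak{X}$ whose support is all of $\mathfrak{X}$. $\mathbf{C}(\mathfrak{X})$ is the Banach space of continuous complex functions on $\mathfrak{X}$ with the supremum norm. $\mathcal{M}=\mathcal{M}_{\mathfrak{X},\mathfrak{m}}$ denotes the Banach $*$-algebra $\mathbf{C}(\mathfrak{X}^2)$ of continuous complex functions on $\mathfrak{X}\times\mathfrak{X}$ with the supremum norm, the multiplication $(f\star g)(x,y)=\int_{\mathfrak{X}}f(x,z)g(z,y)\,d\mathfrak{m}(z)$ and the involution $f^*(x,y)=\overline{f(y,x)}$. For a norm-closed linear subspace $V$ of $\mathbf{C}(\mathfrak{X})$ put $\mathcal{R}_V:=\{f\in\mathcal{M}: f(\cdot,y)\in V\text{ for every }y\in\mathfrak{X}\}$. The pointwise convergence topology (pct) on $\mathbf{C}(\mathfrak{X})$ and on $\mathcal{M}=\mathbf{C}(\mathfrak{X}^2)$ is the topology of pointwise convergence of functions. The column-wise convergence topology (cct) on $\mathcal{M}$ is the vector topology in which $f_\lambda\to f$ iff $\sup_{x}|f_\lambda(x,y)-f(x,y)|\to0$ for every $y\in\mathfrak{X}$.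 pc-closed means closed in the pct, and cc-closure means closure in the cct. *)

(* Defs.v *)
From HB Require Import structures.
From mathcomp Require Import all_boot all_order all_algebra.
From mathcomp Require Import all_classical all_reals all_analysis.
From mathcomp Require Import complex.

Set Implicit Arguments.
Unset Strict Implicit.
Unset Printing Implicit Defensive.

Import Order.TTheory GRing.Theory Num.Theory.
Import numFieldNormedType.Exports.

Local Open Scope classical_set_scope.
Local Open Scope ring_scope.
Local Open Scope complex_scope.

(* The regular module [R[i]^o] is the version of [R[i]] that carries the
   topology of the modulus. *)
Notation Cplx R := (R[i]^o).

Definition metrizable (R : realType) (X : topologicalType) : Prop :=
  exists d : X -> X -> R,
    [/\ forall x y, 0 <= d x y,
        forall x y, d x y = 0 <-> x = y,
        forall x y, d x y = d y x,
        forall x y z, d x z <= d x y + d y z &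
        forall x (A : set X),
          nbhs x A <-> exists2 e : R, 0 < e & [set y | d x y < e] `<=` A].

Notation borel X := (g_sigma_algebraType (@open X)).

Definition msupport (R : realType) (X : ptopologicalType)
    (m : {measure set (borel X) -> \bar R}) : set X :=
  [set x | forall U : set X, open U -> U x -> (0 < m U)%E].

Section FunctionSpaces.
Variables (R : realType) (Y : topologicalType).
Local Notation C := (Cplx R).

Definition contfun : set (Y -> C) := [set f | continuous f].

Definition linear_subspace (S : set (Y -> C)) : Prop :=
  submod_closed (mem S).

(* The topologies of [contfun] are the traces on it of topologies of [Y -> C].
   For [Y] compact, the supremum norm induces uniform convergence. *)
Definition norm_closure (S : set (Y -> C)) : set (Y -> C) :=
  closure (S : set {uniform Y -> C}) `&` contfun.

Definition pc_closure (S : set (Y -> C)) : set (Y -> C) :=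
  closure (S : set {ptws Y -> C}) `&` contfun.

Definition norm_closed (S : set (Y -> C)) : Prop :=
  S `<=` contfun /\ norm_closure S `<=` S.

Definition pc_closed (S : set (Y -> C)) : Prop :=
  S `<=` contfun /\ pc_closure S `<=` S.

Definition norm_closed_subspace (S : set (Y -> C)) : Prop :=
  linear_subspace S /\ norm_closed S.

End FunctionSpaces.
Arguments contfun : clear implicits.

Definition column (X T : Type) (f : X * X -> T) (y : X) : X -> T :=
  fun x => f (x, y).

Section Kernels.
Variables (R : realType) (X : ptopologicalType).
Local Notation C := (Cplx R).

(* The column-wise convergence topology: pointwise in the second variable,
   uniform in the first one. *)
Definition cct : topologicalType :=
  initial_topology
    (@column X C : (X * X -> C) -> {ptws X -> {uniform X -> C}}).

Definition cc_closure (S : set (X * X -> C)) : set (X * X -> C) :=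
  closure (S : set cct) `&` contfun R (X * X)%type.

Definition column_set (S : set (X * X -> C)) : set (X -> C) :=
  [set v | exists f y, S f /\ v = column f y].

Definition kernels_with_columns_in (V : set (X -> C)) : set (X * X -> C) :=
  [set f | continuous f /\ forall y, V (column f y)].

Variable m : {measure set (borel X) -> \bar R}.

Definition cintegral (h : X -> C) : C :=
  (\int[m]_z complex.Re (h z)) +i* (\int[m]_z complex.Im (h z)).

Definition star (f g : X * X -> C) : X * X -> C :=
  fun p => cintegral (fun z => f (p.1, z) * g (z, p.2)).

Definition right_ideal (S : set (X * X -> C)) : Prop :=
  [/\ S `<=` contfun R (X * X)%type,
      linear_subspace S &
      forall f g, S f -> continuous g -> S (star f g)].

End Kernels.

Section Topologies.
Variables (R : realType).
Local Notation C := (Cplx R).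

Lemma entourage_CplxP (E : set (C * C)) :
  entourage E <->
  exists2 e : R, 0 < e & forall a b : C, `|a - b| < e%:C -> E (a, b).
Proof.
rewrite -entourage_from_ballE; split => [[e /= e0 eE]|[e e0 eE]].
  have eR : e = (complex.Re e)%:C.
    by case: e e0 {eE} => a b; rewrite ltcE /= => /andP[/eqP -> _].
  exists (complex.Re e); first by move: e0; rewrite eR ltcR.
  by move=> a b abe; apply: eE; rewrite -ball_normE /= eR.
exists e%:C => /=; first by rewrite ltcR.
by move=> [a b] /=; rewrite -ball_normE /= => abe; exact: eE.
Qed.

Lemma norm_closureP (Y : topologicalType) (S : set (Y -> C)) (f : Y -> C) :
  norm_closure S f <->
  continuous f /\ forall e : R, 0 < e ->
    exists2 g, S g & forall y, `|f y - g y| < e%:C.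
Proof.
split=> [[cSf cf]|[cf Sf]]; split => //.
  move=> e e0; have [|g [Sg fg]] := cSf [set g | forall y, `|f y - g y| < e%:C].
    apply/uniform_nbhs; exists [set ab | `|ab.1 - ab.2| < e%:C].
    split; first by apply/entourage_CplxP; exists e.
    by move=> g /= fg y; exact: fg.
  by exists g.
move=> B /uniform_nbhs[E [/entourage_CplxP[e e0 eE] EB]].
have [g Sg fg] := Sf _ e0; exists g; split => //.
by apply: EB => y _; exact: eE.
Qed.

Lemma initial_cvgP (S : choiceType) (T : topologicalType) (h : S -> T)
    (F : set_system S) (s : S) : Filter F ->
  (F --> (s : initial_topology h)) <-> (h x @[x --> F] --> h s).
Proof.
move=> FF; split=> [Fs A hA|Fs A].
  by apply: Fs; exact: (@initial_continuous _ _ h s).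
rewrite nbhsE => -[B [[D oD <-] Ds] /filterS]; apply.
by apply: Fs; exact: open_nbhs_nbhs.
Qed.

Lemma cc_cvgP (X : ptopologicalType) (F : set_system (X * X -> C))
    (f : X * X -> C) : Filter F ->
  (F --> (f : cct R X)) <->
  forall y (e : R), 0 < e ->
    \forall g \near F, forall x, `|f (x, y) - g (x, y)| < e%:C.
Proof.
move=> FF.
rewrite initial_cvgP cvg_sup; split=> [Ff y e e0|Ff y].
  have /initial_cvgP/(_ [set v | forall x, `|f (x, y) - v x| < e%:C]) := Ff y.
  apply; apply/uniform_nbhs; exists [set ab | `|ab.1 - ab.2| < e%:C].
  split; first by apply/entourage_CplxP; exists e.
  by move=> v /= fv x; exact: (fv x).
apply/initial_cvgP => A.
move=> /(uniform_nbhs (column f y))[E [/entourage_CplxP[e e0 eE] EA]].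
apply: filterS (Ff _ _ e0) => g fg.
by apply: EA => x _; apply: eE; exact: fg.
Qed.

End Topologies.

(* Main.v *)
Require Import Defs.
From HB Require Import structures.
From mathcomp Require Import all_boot all_order all_algebra.
From mathcomp Require Import all_classical all_reals all_analysis.
From mathcomp Require Import complex lra.

(* Let V be the set of columns of I. Multiplying f in I by u (x) 1, where u
   approximates the Dirac mass at y, gives f(., y) (x) 1 in the limit, so
   V = {v | v (x) 1 in I}; hence V inherits from I linearity and closedness, in
   norm or pointwise. Also v (x) w = (v (x) 1) * (1 (x) w) is in I for v in V.
   For f with columns in V, a combination of such v (x) w agrees with f on any
   given finite set of columns, so f is in the cc-closure of I. *)

Set Implicit Arguments.
Unset Strict Implicit.
Unset Printing Implicit Defensive.

Import Order.TTheory GRing.Theory Num.Theory.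
Import numFieldNormedType.Exports.

Local Open Scope classical_set_scope.
Local Open Scope ring_scope.
Local Open Scope complex_scope.

(** * Continuity and moduli of complex-valued functions *)

Section ComplexValued.
Variables (R : realType) (T : topologicalType).

Lemma continuous_CplxP (f : T -> Cplx R) :
  continuous f <->
  forall x (e : R), 0 < e -> \forall y \near x, `|f x - f y| < e%:C.
Proof.
split=> [cf x e e0|cf x].
  by move/cvgrPdist_lt : (cf x); apply; rewrite ltcR.
apply/cvgrPdist_lt => e e0.
(* A positive element of [R[i]] is real, since the order of [R[i]] only compares numbers with equal
   imaginary parts. *)
have eR : e = (complex.Re e)%:C.
  by case: e e0 => a b; rewrite ltcE /= => /andP[/eqP -> _].
by rewrite eR; apply: cf; move: e0; rewrite eR ltcR.
Qed.

Lemma normc_ge_Im (z : R[i]) : `|complex.Im z|%:C <= `|z|.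
Proof.
by case: z => a b; simpc; rewrite -sqrtr_sqr ler_wsqrtr // lerDr sqr_ge0.
Qed.

Lemma normc_le_ReIm (z : R[i]) :
  `|z| <= (`|complex.Re z| + `|complex.Im z|)%:C.
Proof.
rewrite {1}[z]complexE (le_trans (ler_normD _ _))// normrM.
rewrite rmorphD /= !normc_def /= !expr0n /= !addr0 !add0r expr1n sqrtr1 mul1r.
by rewrite !sqrtr_sqr lexx.
Qed.

Lemma continuous_Re (f : T -> Cplx R) :
  continuous f -> continuous (fun x => complex.Re (f x) : R).
Proof.
move/continuous_CplxP => cf x; apply/cvgrPdist_lt => e e0.
apply: filterS (cf x e e0) => y; rewrite -ltcR -raddfB.
exact/le_lt_trans/normc_ge_Re.
Qed.

Lemma continuous_Im (f : T -> Cplx R) :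
  continuous f -> continuous (fun x => complex.Im (f x) : R).
Proof.
move/continuous_CplxP => cf x; apply/cvgrPdist_lt => e e0.
apply: filterS (cf x e e0) => y; rewrite -ltcR -raddfB.
exact/le_lt_trans/normc_ge_Im.
Qed.

Lemma continuous_real_complex (u : T -> R) :
  continuous u -> continuous (fun x => (u x)%:C : Cplx R).
Proof.
move=> cu; apply/continuous_CplxP => x e e0.
move/cvgrPdist_lt : (cu x) => /(_ _ e0).
apply: filterS => y uxy; rewrite -raddfB.
by rewrite (le_lt_trans (normc_le_ReIm _))//= normr0 addr0 ltcR.
Qed.

End ComplexValued.

(** * Approximate Dirac masses on a compact metrizable space *)

Section Bump.
Variables (R : realType) (X : ptopologicalType).

(** Here [q] is the distance to [y]; these four facts are all that is used of a compatible metric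
    below. *)
Lemma metrizable_gauge (y : X) : metrizable R X ->
  exists q : X -> R, [/\ continuous q, forall z, 0 <= q z,
    forall z, q z = 0 <-> z = y &
    forall A, nbhs y A -> exists2 e : R, 0 < e & [set z | q z < e] `<=` A].
Proof.
move=> [d [d_ge0 d_eq0 dC d_tri d_nbhs]]; exists (d y); split => //.
- move=> x; apply/cvgrPdist_lt => e e0; apply/d_nbhs; exists e => // z /= xz.
  have := d_tri y x z; have := d_tri y z x; rewrite (dC z x) => yzx yxz.
  by rewrite ltr_norml; apply/andP; split; lra.
- by move=> z; split => [/d_eq0 ->//|->]; apply/d_eq0.
- by move=> A /d_nbhs.
Qed.

Hypothesis X_compact : compact [set: X].
Variable m : probability (borel X) R.

(** Compactness bounds [h], preimages of open intervals are open and hence Borel, and the measure is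
    finite. *)
Lemma continuous_integrable (h : X -> R) :
  continuous h -> m.-integrable [set: borel X] (EFin \o h).
Proof.
move=> ch; apply: measurable_bounded_integrable => //.
- by apply: (le_lt_trans (probability_le1 m measurableT)); exact: ltry.
- apply: (measurability _ (measurable_realfun.RGenOpens.measurableE R)).
  move=> _ [_ [a [b ->] <-]]; rewrite setTI; apply: sub_sigma_algebra.
  by apply: open_comp => // x _; exact: ch.
- have : compact (h @` [set: X]).
    by apply: continuous_compact => //; exact: continuous_subspaceT.
  move=> /compact_bounded[M [Mr hM]]; exists M; split => // N MN x _.
  by apply: (hM N MN); exists x.
Qed.

Hypothesis X_metrizable : metrizable R X.
Hypothesis m_support : msupport m = [set: X].

(** Normalise the tent max(0, e - q), which vanishes off the ball [q < e]. Its integral is positive: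
    the tent is at least e / 2 on the ball [W] of half the radius, an open set containing [y], which
    has positive measure by full support. *)
Lemma bump_function (y : X) (U : set X) : nbhs y U ->
  exists u : X -> R, [/\ continuous u, forall z, 0 <= u z,
    forall z, ~ U z -> u z = 0 & \int[m]_z u z = 1].
Proof.
have [q [cq q_ge0 q_eq0 q_nbhs]] := metrizable_gauge y X_metrizable.
move=> /q_nbhs[e e0 qU].
pose t z := Num.max 0 (e - q z).
have ct : continuous t.
  move=> z; apply: (@continuous_max _ _ (cst 0) (fun z => e - q z)).
    exact: cvg_cst.
  by apply: cvgB; [exact: cvg_cst|exact: cq].
have t_ge0 z : 0 <= t z by rewrite le_max lexx.
pose W := [set z | q z < e / 2].
have oW : open W.
  apply: (@open_comp _ _ q [set r : R | r < e / 2]) => [z _|]; first exact: cq.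
  exact: open_lt.
have mW : measurable (W : set (borel X)) by exact: sub_sigma_algebra.
have Wy : W y by rewrite /W /= (q_eq0 y).2// divr_gt0.
have mW0 : (0 < m W)%E.
  by have : msupport m y by [rewrite m_support]; exact.
have it := continuous_integrable ct.
have c0 : 0 < \int[m]_z t z.
  rewrite -(setUv W) Rintegral_setU ?setUv//; last 2 first.
  - exact: measurableC.
  - exact/disj_setPCl.
  apply: (@lt_le_trans _ _ (\int[m]_(z in W) (e / 2))).
    rewrite Rintegral_cst// mulr_gt0 ?divr_gt0// fine_gt0// mW0/=.
    exact: le_lt_trans (probability_le1 m mW) (ltry _).
  rewrite -[leLHS]addr0 lerD//; last exact: Rintegral_ge0.
  apply: le_Rintegral => //.
  - by apply: integrableS (continuous_integrable (@cst_continuous _ _ (e / 2))).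
  - exact: integrableS it.
  - by move=> z; rewrite /W /= /t le_max => qz; apply/orP; right; lra.
exists (fun z => (\int[m]_z t z)^-1 * t z); split.
- by move=> z; apply: cvgM; [exact: cvg_cst|exact: ct].
- by move=> z; rewrite mulr_ge0// invr_ge0 ltW.
- move=> z Uz; rewrite /t max_l ?mulr0//.
  by rewrite subr_le0 leNgt; apply/negP => /qU.
- by rewrite RintegralZl// mulVf// gt_eqF.
Qed.

(** A weighted mean of values within [e] of [c] stays within [e] of [c]: as [u] has mass one, both
    [c] and [e] can be written as integrals against [u]. *)
Lemma Rintegral_bump (U : set X) (u h : X -> R) (c e : R) :
  continuous u -> (forall z, 0 <= u z) -> (forall z, ~ U z -> u z = 0) ->
  \int[m]_z u z = 1 -> continuous h -> (forall z, U z -> `|h z - c| <= e) ->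
  `|\int[m]_z (h z * u z) - c| <= e.
Proof.
move=> cu u0 uU u1 ch hc.
have chu : continuous (fun z => h z * u z).
  by move=> z; apply: cvgM; [exact: ch|exact: cu].
have ccu k : continuous (fun z => k * u z).
  by move=> z; apply: cvgM; [exact: cvg_cst|exact: cu].
have -> : c = \int[m]_z (c * u z).
  by rewrite RintegralZl ?u1 ?mulr1//; exact: continuous_integrable.
rewrite -RintegralB//; [|exact: continuous_integrable..].
have cB : continuous (fun z => h z * u z - c * u z).
  by move=> z; apply: cvgB; [exact: chu|exact: ccu].
apply: le_trans (le_normr_Rintegral _ (continuous_integrable cB)) _ => //.
have -> : e = \int[m]_z (e * u z).
  by rewrite RintegralZl ?u1 ?mulr1//; exact: continuous_integrable.
apply: le_Rintegral => //; [|exact: continuous_integrable|].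
  by apply: continuous_integrable => z; apply: cvg_norm; exact: cB.
move=> z _; rewrite -mulrBl normrM (ger0_norm (u0 z)).
have [/hc|/uU ->] := pselect (U z); last by rewrite !mulr0.
by move=> ?; rewrite ler_wpM2r.
Qed.

End Bump.

(** * Columns of a closed right ideal *)

Section RightIdeal.
Variables (R : realType) (X : ptopologicalType).
Hypothesis X_compact : compact [set: X].
Hypothesis X_metrizable : metrizable R X.
Variable m : probability (borel X) R.
Hypothesis m_support : msupport m = [set: X].

Lemma cintegral_cst (c : Cplx R) : cintegral m (fun=> c) = c.
Proof.
by rewrite /cintegral !Rintegral_cst//= probability_setT !mulr1; case: c.
Qed.

Lemma continuous_column (f : X * X -> Cplx R) (y : X) :
  continuous f -> continuous (column f y).
Proof.
move=> cf x; apply: (@cvg_comp _ _ _ (fun x => (x, y)) f); last exact: cf.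
by apply: cvg_pair => //; exact: cvg_cst.
Qed.

Lemma continuous_fst_comp (v : X -> Cplx R) :
  continuous v -> continuous (fun p : X * X => v p.1).
Proof.
move=> cv p; apply: (@cvg_comp _ _ _ fst v); last exact: cv.
exact: cvg_fst.
Qed.

(** Compactness of [X] makes the estimate uniform in [x]. Locally, [f (x', z)] and [f (x', y)] are
    both compared with [f (x, y)], at a cost of e / 2 each. *)
Lemma near_column (f : X * X -> Cplx R) (y : X) (e : R) :
  continuous f -> 0 < e ->
  \forall z \near y, forall x, `|f (x, z) - f (x, y)| < e%:C.
Proof.
move=> /continuous_CplxP cf e0.
have /compact_near_coveringP cX := X_compact.
have : \forall z \near y,
    [set: X] `<=` (fun x => `|f (x, z) - f (x, y)| < e%:C).
  apply: cX => x _.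
  have e2 : 0 < e / 2 by rewrite divr_gt0.
  have [[A B] /= [xA yB] AB] := cf (x, y) _ e2.
  exists (A, B) => // -[x' z] [/= Ax' Bz].
  have h1 := AB (x', z) (conj Ax' Bz).
  have h2 := AB (x', y) (conj Ax' (nbhs_singleton yB)).
  rewrite [e]splitr rmorphD /= -(subrKA (f (x, y))).
  by rewrite (le_lt_trans (ler_normD _ _))// ltrD// distrC.
by apply: filterS => z zP x; exact: zP.
Qed.

Variable I : set (X * X -> Cplx R).
Hypotheses (I_ideal : right_ideal m I) (I_closed : norm_closed I).

Lemma ideal_column (f : X * X -> Cplx R) (y : X) :
  I f -> I (fun p => column f y p.1).
Proof.
move=> If; have [I_cont _ I_star] := I_ideal.
have cf : continuous f by exact: I_cont.
apply: I_closed.2; apply/norm_closureP; split.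
  exact/continuous_fst_comp/continuous_column.
move=> e e0; have e4 : 0 < e / 4 by rewrite divr_gt0.
(* The neighbourhood of [y] given by [near_column] does not depend on [x], so one [u] serves all
   rows. Real and imaginary parts will cost e / 4 each, and e / 2 < e absorbs the non-strict
   bounds. *)
have [u [cu u_ge0 u_out u_int]] :=
  bump_function X_compact X_metrizable m_support (near_column y cf e4).
exists (star m f (fun p => (u p.1)%:C)).
  apply: I_star => //.
  exact: continuous_fst_comp (continuous_real_complex cu).
move=> [x x'] /=; rewrite /star /= distrC.
have cfx : continuous (fun z => f (x, z)).
  move=> z; apply: (@cvg_comp _ _ _ (fun z => (x, z)) f); last exact: cf.
  by apply: cvg_pair => //; exact: cvg_cst.
apply: le_lt_trans (normc_le_ReIm _) _; rewrite ltcR !raddfB /=.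
(* [part] stands for the real or the imaginary part; both commute with multiplication by the real
   number [u z]. *)
have near_part (part : Cplx R -> R) :
    (forall z, `|part z|%:C <= `|z|) ->
    (forall z t, part (z - t) = part z - part t) ->
    (forall z (r : R), part (z * r%:C) = part z * r) ->
    continuous (fun z => part (f (x, z))) ->
    `|\int[m]_z part (f (x, z) * (u z)%:C) - part (f (x, y))| <= e / 4.
  move=> part_le partB partM cpart; under eq_Rintegral do rewrite partM.
  apply: (Rintegral_bump X_compact cu u_ge0 u_out u_int cpart) => z /(_ x).
  move=> fzy; rewrite -partB -lecR; exact/ltW/(le_lt_trans (part_le _)).
have bRe := near_part _ (@normc_ge_Re R) (raddfB _) _ (continuous_Re cfx).
have bIm := near_part _ (@normc_ge_Im R) (raddfB _) _ (continuous_Im cfx).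
apply: (@le_lt_trans _ _ (e / 4 + e / 4)); last by lra.
by apply: lerD; [apply: bRe|apply: bIm] => -[a b] r /=;
  rewrite mulr0 ?subr0 ?add0r.
Qed.

(** Two columns may come from different functions and different points, so linearity of
    [column_set I] is not visible from its definition; this form removes both choices. *)
Lemma column_setE (v : X -> Cplx R) :
  column_set I v <-> I (fun p => v p.1).
Proof.
split=> [[f [y [If ->]]]|Iv]; first exact: ideal_column.
(* All columns of v (x) 1 are equal to [v], so any point would do. *)
by exists (fun p => v p.1), point.
Qed.

Lemma ideal_tensor (v : X -> Cplx R) (w : X -> R) :
  column_set I v -> continuous w -> I (fun p => v p.1 * (w p.2)%:C).
Proof.
move=> /column_setE Iv cw; have [_ _ I_star] := I_ideal.
have -> : (fun p : X * X => v p.1 * (w p.2)%:C) =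
    star m (fun p => v p.1) (fun p => (w p.2)%:C).
  (* The integrand is constant in the integration variable and [m] has total mass one. *)
  by apply/funext => -[x y]; rewrite /star /= cintegral_cst.
apply: I_star => // p.
apply: (@cvg_comp _ _ _ snd (fun y => (w y)%:C : Cplx R)); first exact: cvg_snd.
exact: continuous_real_complex.
Qed.

Lemma idealB f g : I f -> I g -> I (f - g).
Proof.
have [_ [_ I_lin] _] := I_ideal.
move=> If Ig; have := I_lin (-1) g f (mem_set Ig) (mem_set If).
by rewrite scaleN1r addrC => /set_mem.
Qed.

Lemma column_set_submod : linear_subspace (column_set I).
Proof.
have [_ [I0 I_lin] _] := I_ideal; split=> [|a u v /set_mem Vu /set_mem Vv].
  by apply/mem_set/column_setE; exact: set_mem I0.
apply/mem_set/column_setE.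
apply: set_mem (I_lin a _ _ (mem_set _) (mem_set _)); exact/column_setE.
Qed.

Lemma column_set_norm_closed : norm_closed (column_set I).
Proof.
have [I_cont _ _] := I_ideal; split=> [_ [f [y [/I_cont cf ->]]]|v].
  exact: continuous_column.
move=> /norm_closureP[cv Vv]; apply/column_setE/I_closed.2/norm_closureP.
split=> [|e /Vv[w /column_setE Iw vw]]; first exact: continuous_fst_comp.
by exists (fun p => w p.1).
Qed.

Lemma column_set_pc_closed : pc_closed I -> pc_closed (column_set I).
Proof.
move=> [_ I_pc]; split=> [|v [clv cv]]; first exact: column_set_norm_closed.1.
apply/column_setE/I_pc; split; last exact: continuous_fst_comp.
(* The map w |-> w (x) 1 is continuous for the pointwise topologies: its value at [p] is evaluation
   at [p.1]. *)
pose lift (w : {ptws X -> Cplx R}) : {ptws X * X -> Cplx R} := fun p => w p.1.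
have lift_cvg : lift @ nbhs (v : {ptws X -> Cplx R}) --> lift v.
  apply/pointwise_cvgP => p.
  exact: (pointwise_cvgP (F := nbhs (v : {ptws X -> Cplx R})) v _).1.
move=> B /lift_cvg /clv[w [/column_setE Iw Bw]].
by exists (lift w).
Qed.

(** * Interpolation of finitely many columns, and the cc-closure *)

Lemma separating_function (y : X) (s : seq X) : y \notin s ->
  exists w : X -> R,
    [/\ continuous w, w y = 1 & forall z, z \in s -> w z = 0].
Proof.
elim: s => [_|z s IHs].
  by exists (cst 1); split=> //; exact: cst_continuous.
rewrite inE negb_or => /andP[yz /IHs[w [cw wy ws]]].
have [q [cq _ q_eq0 _]] := metrizable_gauge z X_metrizable.
have qy : q y != 0 by apply: contra_neq yz => /q_eq0.
(* The new factor is the distance to [z], scaled to be 1 at [y]. *)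
exists (fun x => (q y)^-1 * q x * w x); split.
- move=> x; apply: cvgM; last exact: cw.
  by apply: cvgM; [exact: cvg_cst|exact: cq].
- by rewrite wy mulVf// mulr1.
- move=> x; rewrite inE => /predU1P[->|/ws ->]; last by rewrite mulr0.
  by rewrite (q_eq0 z).2// mulr0 mul0r.
Qed.

(** As in Newton interpolation, a new point [y] is handled by adding the defect of column [y] times
    a function [w] that is 1 at [y] and 0 on the earlier points. The defect is in [column_set I] by
    linearity, so the correction is in [I]. *)
Lemma ideal_interpolation (f : X * X -> Cplx R) (s : seq X) :
  (forall y, column_set I (column f y)) ->
  exists2 g, I g & forall y, y \in s -> column g y = column f y.
Proof.
move=> Vf; have [_ [I0 I_lin] _] := I_ideal.
elim: s => [|y s [g Ig gf]]; first by exists 0 => //; exact: set_mem I0.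
have [ys|ys] := boolP (y \in s).
  by exists g => // z; rewrite inE => /predU1P[->|]; exact: gf.
have [w [cw wy ws]] := separating_function ys.
have Vh : column_set I (column f y - column g y).
  have [_ V_lin] := column_set_submod.
  have Vg : column_set I (column g y) by exists g, y.
  have := V_lin (-1) _ _ (mem_set Vg) (mem_set (Vf y)).
  by rewrite scaleN1r addrC => /set_mem.
have Ih := ideal_tensor Vh cw.
exists ((1 : R[i]) *:
    (fun p => (column f y - column g y) p.1 * (w p.2)%:C) + g).
  exact: set_mem (I_lin 1 _ _ (mem_set Ih) (mem_set Ig)).
move=> z; rewrite scale1r inE => zs; apply/funext => x.
rewrite /column /= !fctE /=.
case/predU1P: zs => [->|zs]; first by rewrite wy mulr1 subrK.
by rewrite ws// mulr0 add0r -/(column g z x) gf.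
Qed.

Lemma cc_closure_ideal :
  cc_closure I = kernels_with_columns_in (column_set I).
Proof.
apply/seteqP; split=> f.
  move=> [clf cf]; split=> // y.
  apply: column_set_norm_closed.2; apply/norm_closureP.
  split=> [|e e0]; first exact: continuous_column.
  have nbhs_f : nbhs (f : cct R X) --> (f : cct R X) by exact: cvg_id.
  have [g [Ig fg]] := clf _ ((cc_cvgP _ _).1 nbhs_f y e e0).
  by exists (column g y) => //; exists g, y.
move=> [cf Vf]; split=> // B fB.
pose agree (s : seq X) := [set g |
  I g /\ forall y, y \in s -> column g y = column f y].
(* [F] converges to [f] because convergence in [cct] is tested one column at a time, and on [agree
   [:: y]] column [y] is exact. Each [agree s] is nonempty by [ideal_interpolation], so every
   neighbourhood [B] of [f] meets [I]. *)
pose F := filter_from [set: seq X] agree.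
have FF : Filter F.
  apply: filter_from_filter; first by exists [::].
  move=> s t _ _; exists (s ++ t) => // g [Ig gf].
  by split; split=> // y ys; apply: gf; rewrite mem_cat ys ?orbT.
have /(_ B fB) [s _ sB] : F --> (f : cct R X).
  apply/cc_cvgP.
  move=> y e e0; exists [:: y] => // g [_ gf] x.
  have := gf y (mem_head _ _) => /(congr1 (@^~ x)); rewrite /column => ->.
  by rewrite subrr normr0 ltcR.
have [g Ig gf] := ideal_interpolation s Vf.
by exists g; split=> //; exact: sB.
Qed.

End RightIdeal.

Theorem theorem5p2 (R : realType) (X : ptopologicalType)
    (X_compact : compact [set: X]) (X_metrizable : metrizable R X)
    (m : probability (borel X) R) (m_support : msupport m = [set: X])
    (I : set (X * X -> Cplx R))
    (I_ideal : right_ideal m I) (I_closed : norm_closed I) :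
  [/\ norm_closed_subspace (column_set I),
      cc_closure I = kernels_with_columns_in (column_set I) &
      pc_closed I -> pc_closed (column_set I)].
Proof.
split.
- split; first exact: (column_set_submod X_compact X_metrizable m_support).
  exact: (column_set_norm_closed X_compact X_metrizable m_support I_ideal).
- exact: (cc_closure_ideal X_compact X_metrizable m_support).
- exact: (column_set_pc_closed X_compact X_metrizable m_support I_ideal).
Qed.
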